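(* Let $Q$ be a topological groupoid on a topological space $X$, and let $\mathcal{U}=\{U_i : i\in I\}$ be an open cover of $X$ which is path compatible with $Q$, so that the local subgroupoid $c_1(Q,\mathcal{U})$ of $Q$ is well defined. Then: (i) $glob(c_1(Q,\mathcal{U}))=C_1(Q)$; (ii) $c_1(Q,\mathcal{U})$ is coherent; (iii) if $\mathcal{U}$ is path local for $c_1(Q,\mathcal{U})$, then $c_1(Q,\mathcal{U})$ is totally coherent.
   Context: A groupoid $Q$ on $X$ has object set $X$, source $\alpha$ and target $\beta$; $gh$ is defined iff $\beta(g)=\alpha(h)$. A topological groupoid on $X$ has topologies on its set of arrows and on its object space $X$ making all structure maps continuous; subgroupoids get the subspace topology. A subgroupoid is wide if it has all objects. For $U\subseteq X$, $Q|U$ is the full subgroupoid on $U$ (and similarly $H|W$ for a subgroupoid $H$). The star $\mathrm{St}_Q x$ is the set of arrows with source $x$. The star identity path component $C_1(Q)$ is the set of $g\in Q$ such that, with $x=\alpha(g)$, there is a path in $\mathrm{St}_Q x$ joining $g$ to $1_x$; it is a wide subgroupoid of $Q$. Local subgroupoids: for $x\in X$, consider pairs $(U,H)$ with $U$ an open neighbourhood of $x$ and $H$ a wide subgroupoid of $Q|U$. Pairs $(U,H)$, $(V,K)$ have the same germ at $x$, $[U,H]_x=[V,K]_x$, iff $H|W=K|W$ for some open $W$ with $x\in W\subseteq U\cap V$. A local subgroupoid $s$ of $Q$ assigns to each $x\in X$ a germ $s(x)$ at $x$ such that each point of $X$ has an open neighbourhood $U$ and a wide subgroupoid $H$ of $Q|U$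 with $s(y)=[U,H]_y$ for all $y\in U$ (equivalently, a continuous global section of the sheaf associated to the presheaf $U\mapsto\{\text{wide subgroupoids of } Q|U\}$). For $U$ open in $X$, $s|U$ is the local subgroupoid of $Q|U$ obtained by restricting $s$ to $U$. Order: $[U',H']_x\leq[U,H]_x$ iff there is an open $W$ with $x\in W\subseteq U\cap U'$ and $H'|W$ a subgroupoid of $H|W$; $s\leq t$ iff $s(x)\leq t(x)$ for all $x$. For a wide subgroupoid $H$ of $Q$, $loc(H)(x)=[X,H]_x$. For a local subgroupoid $s$ of $Q$, $glob(s)$ is the intersection of all wide subgroupoids $H$ of $Q$ with $s\leq loc(H)$. For local subgroupoids of $Q|U$, $loc$ and $glob$ are taken relative to $Q|U$. A local subgroupoid $s$ is coherent if $s\leq loc(glob(s))$, and totally coherent if $s|U$ is coherent for every open $U\subseteq X$. The cover $\mathcal U$ is path compatible with $Q$ if for all $i,j\in I$ and $x\in U_i\cap U_j$ there is an open $W$ with $x\in W\subseteq U_i\cap U_j$ and $C_1(Q|U_i)|W=C_1(Q|U_j)|W$; then $c_1(Q,\mathcal U)$ is the local subgroupoid with value $[U_i,C_1(Q|U_i)]_x$ at $x\in U_i$. The cover $\mathcal U$ is path local for $c_1(Q,\mathcal U)$ if for every open $U\subseteq X$, all $i,j\in I$ and $x\in U_i\cap U_j\cap U$ there is an open $W$ with $x\in W\subseteq U_i\cap U_j\cap U$ and $C_1(Q|U_i)|W=C_1(Q|(U_j\cap U))|W$. *)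

(* Defs.v *)
From mathcomp Require Import all_boot all_order all_algebra.
From mathcomp Require Import mathcomp_extra boolp classical_sets functions.
From mathcomp Require Import reals topology normedtype.
From mathcomp Require Import lra.

Set Implicit Arguments.
Unset Strict Implicit.
Unset Printing Implicit Defensive.

Import Order.TTheory GRing.Theory Num.Theory numFieldNormedType.Exports.
Local Open Scope classical_set_scope.
Local Open Scope ring_scope.

(* The partial composition gh, defined iff tgt g = src h, is encoded by a total
   function [gcomp] with arbitrary values on non-composable pairs: the axioms
   and the continuity only concern composable pairs. *)
Record topGroupoid (X : topologicalType) := TopGroupoid {
  arrow :> topologicalType;
  src : arrow -> X;
  tgt : arrow -> X;
  gid : X -> arrow;
  ginv : arrow -> arrow;
  gcomp : arrow -> arrow -> arrow;
  src_gid : forall x, src (gid x) = x;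
  tgt_gid : forall x, tgt (gid x) = x;
  src_ginv : forall g, src (ginv g) = tgt g;
  tgt_ginv : forall g, tgt (ginv g) = src g;
  src_gcomp : forall g h, tgt g = src h -> src (gcomp g h) = src g;
  tgt_gcomp : forall g h, tgt g = src h -> tgt (gcomp g h) = tgt h;
  gcompA : forall g h k, tgt g = src h -> tgt h = src k ->
    gcomp g (gcomp h k) = gcomp (gcomp g h) k;
  gcomp1g : forall g, gcomp (gid (src g)) g = g;
  gcompg1 : forall g, gcomp g (gid (tgt g)) = g;
  gcompVg : forall g, gcomp (ginv g) g = gid (tgt g);
  gcompgV : forall g, gcomp g (ginv g) = gid (src g);
  src_continuous : continuous src;
  tgt_continuous : continuous tgt;
  gid_continuous : continuous gid;
  ginv_continuous : continuous ginv;
  gcomp_continuous : {within [set p : arrow * arrow | tgt p.1 = src p.2],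
    continuous (fun p : arrow * arrow => gcomp p.1 p.2)}
}.

Record opens (X : topologicalType) := Opens {
  oset : X -> Prop;
  oset_open : open (oset : set X)
}.
Coercion oset : opens >-> Funclass.

Definition opensT (X : topologicalType) : opens X := Opens (@openT X).
Definition opensI (X : topologicalType) (U V : opens X) : opens X :=
  Opens (openI (oset_open U) (oset_open V)).

Section Subgroupoids.
Context (X : topologicalType) (Q : topGroupoid X).

(* The full subgroupoid Q|U, as a set of arrows of Q. *)
Definition full (U : set X) : set Q := [set g | U (src g) /\ U (tgt g)].

(* H|W, for a set H of arrows. *)
Definition restr (H : set Q) (W : set X) : set Q := H `&` full W.

(* Wide subgroupoids of Q|U.  All subgroupoids are sets of arrows of the ambient
   Q, so those of Q|U and of Q|V can be compared after restriction; the wide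
   subgroupoids of Q itself are those of Q|X, i.e. U = opensT X. *)
Record wide_subgroupoid (U : opens X) := WideSubgroupoid {
  arrows : Q -> Prop;
  arrows_full : (arrows : set Q) `<=` full U;
  arrows_id : forall x, U x -> arrows (gid Q x);
  arrows_inv : forall g, arrows g -> arrows (ginv g);
  arrows_comp : forall g h, arrows g -> arrows h -> tgt g = src h ->
    arrows (gcomp g h)
}.
Coercion arrows : wide_subgroupoid >-> Funclass.

Lemma restr_full (H : set Q) (W W' : set X) : W' `<=` W ->
  restr (restr H W) W' = restr H W'.
Proof.
move=> WW; rewrite /restr -setIA; congr (_ `&` _).
by apply/seteqP; split=> [g [_ //]|g [a b]]; split; split=> //; exact: WW.
Qed.

Lemma restrS (H K : set Q) (W W' : set X) : W' `<=` W ->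
  restr H W `<=` restr K W -> restr H W' `<=` restr K W'.
Proof.
move=> WW HK; rewrite -(restr_full H WW) -(restr_full K WW).
by move=> g [/HK ? ?].
Qed.

Lemma restr_eqS (H K : set Q) (W W' : set X) : W' `<=` W ->
  restr H W = restr K W -> restr H W' = restr K W'.
Proof. by move=> WW HK; rewrite -(restr_full H WW) HK restr_full. Qed.

Definition germ_eq (x : X) (U : opens X) (H : wide_subgroupoid U)
    (V : opens X) (K : wide_subgroupoid V) : Prop :=
  exists W : opens X,
    [/\ W x, W `<=` U `&` V & restr H W = restr K W].

(* The germ [U,H]_x is the equivalence class of the pair (U,H). *)
Definition pregerm := {U : opens X & wide_subgroupoid U}.
Definition germ (x : X) (U : opens X) (H : wide_subgroupoid U) : set pregerm :=
  [set p | germ_eq x H (projT2 p)].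

Lemma germ_eq_refl x U (H : wide_subgroupoid U) : U x -> germ_eq x H H.
Proof. by move=> Ux; exists U; split=> // y Uy; split. Qed.

Lemma germ_eq_sym x U (H : wide_subgroupoid U) V (K : wide_subgroupoid V) :
  germ_eq x H K -> germ_eq x K H.
Proof.
by move=> [W [Wx WUV HK]]; exists W; split=> // y /WUV[].
Qed.

Lemma germ_eq_trans x U (H : wide_subgroupoid U) V (K : wide_subgroupoid V)
    T (L : wide_subgroupoid T) :
  germ_eq x H K -> germ_eq x K L -> germ_eq x H L.
Proof.
move=> [W [Wx WUV HK]] [W' [Wx' WUV' KL]]; exists (opensI W W'); split=> //.
  by move=> y [/WUV[? _] /WUV'[_ ?]].
rewrite (restr_eqS _ HK); last by move=> y [].
by rewrite (restr_eqS _ KL) // => y [].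
Qed.

Lemma germP x U (H : wide_subgroupoid U) V (K : wide_subgroupoid V) :
  V x -> germ x H = germ x K <-> germ_eq x H K.
Proof.
move=> Vx; split=> [HK|HK].
  suff : germ x H (existT _ V K) by [].
  by rewrite HK; exact: germ_eq_refl.
apply/seteqP; split=> -[T L] /=; last exact: germ_eq_trans.
exact: (germ_eq_trans (germ_eq_sym HK)).
Qed.

Definition germ_le (x : X) (s t : set pregerm) : Prop :=
  exists (U' : opens X) (H' : wide_subgroupoid U')
         (U : opens X) (H : wide_subgroupoid U),
    [/\ s = germ x H', t = germ x H &
      exists W : opens X,
        [/\ W x, W `<=` U `&` U' & restr H' W `<=` restr H W]].

(* The order on germs does not depend on the representatives. *)
Lemma germ_leP x U' (H' : wide_subgroupoid U') U (H : wide_subgroupoid U) :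
  U' x -> U x ->
  germ_le x (germ x H') (germ x H) <->
  exists W : opens X,
    [/\ W x, W `<=` U `&` U' & restr H' W `<=` restr H W].
Proof.
move=> Ux' Ux; split=> [|HH]; last by exists U', H', U, H; split.
move=> [V' [K' [V [K [e' e [W [Wx WVV KK]]]]]]].
have [Vx Vx'] := WVV _ Wx.
have [W' [Wx' WUV' HK']] := (germP H' K' Vx').1 e'.
have [W'' [Wx'' WUV HK]] := (germP H K Vx).1 e.
exists (opensI W (opensI W' W'')); split=> //.
  by move=> y [_ [/WUV'[? _] /WUV[? _]]].
rewrite (restr_eqS _ HK'); last by move=> y [_ []].
rewrite (restr_eqS _ HK); last by move=> y [_ []].
by apply: restrS KK => y [].
Qed.

(* Local subgroupoids of Q|U.  As U is open, the germs at x in U of wide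
   subgroupoids of the restrictions of Q|U and of Q are the same, and we use the
   latter.  The values outside of U are irrelevant. *)
Record local_subgroupoid (U : opens X) := LocalSubgroupoid {
  germ_at :> X -> set pregerm;
  germ_at_local : forall x, U x ->
    exists (V : opens X) (H : wide_subgroupoid V),
      [/\ V x, V `<=` U & forall y, V y -> germ_at y = germ y H]
}.

Definition local_le (U : opens X) (s t : local_subgroupoid U) : Prop :=
  forall x, U x -> germ_le x (s x) (t x).

Section RestrictWide.
Context (U : opens X) (H : wide_subgroupoid U) (W : opens X).

Fact restrict_wide_full : restr H W `<=` full (opensI U W).
Proof. by move=> g [/arrows_full[? ?] [? ?]]; split; split. Qed.

Fact restrict_wide_id x : opensI U W x -> restr H W (gid Q x).
Proof.
by move=> [Ux Wx]; split; [exact: arrows_id|split; rewrite ?src_gid ?tgt_gid].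
Qed.

Fact restrict_wide_inv g : restr H W g -> restr H W (ginv g).
Proof.
move=> [Hg [? ?]]; split; first exact: arrows_inv.
by split; rewrite ?src_ginv ?tgt_ginv.
Qed.

Fact restrict_wide_comp g h : restr H W g -> restr H W h -> tgt g = src h ->
  restr H W (gcomp g h).
Proof.
move=> [Hg [? ?]] [Hh [? ?]] gh; split; first exact: arrows_comp.
by split; rewrite ?src_gcomp ?tgt_gcomp.
Qed.

Definition restrict_wide : wide_subgroupoid (opensI U W) :=
  WideSubgroupoid restrict_wide_full restrict_wide_id restrict_wide_inv
    restrict_wide_comp.

Lemma germ_restrict_wide x : U x -> W x -> germ x H = germ x restrict_wide.
Proof.
move=> Ux Wx; apply/germP => //; exists (opensI U W); split=> //.
  by move=> y [? ?]; split=> //; split.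
by rewrite restr_full // => y [].
Qed.

End RestrictWide.

Section Restrict.
Context (s : local_subgroupoid (opensT X)) (U : opens X).

Fact restrict_local x : U x ->
  exists (V : opens X) (H : wide_subgroupoid V),
    [/\ V x, V `<=` U & forall y, V y -> s y = germ y H].
Proof.
move=> Ux; have [V [H [Vx _ sH]]] := @germ_at_local _ s x I.
exists (opensI V U), (restrict_wide H U); split=> // y [Vy Uy] //.
by rewrite (sH _ Vy); exact: germ_restrict_wide.
Qed.

(* s|U *)
Definition restrict : local_subgroupoid U := LocalSubgroupoid restrict_local.

End Restrict.

Section Loc.
Context (U : opens X) (H : wide_subgroupoid U).

Fact loc_local x : U x ->
  exists (V : opens X) (K : wide_subgroupoid V),
    [/\ V x, V `<=` U & forall y, V y -> germ y H = germ y K].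
Proof. by move=> Ux; exists U, H; split. Qed.

Definition loc : local_subgroupoid U := LocalSubgroupoid loc_local.

End Loc.

Section FullWide.
Context (U : opens X).

Fact full_wide_id x : U x -> full U (gid Q x).
Proof. by move=> Ux; split; rewrite ?src_gid ?tgt_gid. Qed.

Fact full_wide_inv g : full U g -> full U (ginv g).
Proof. by move=> [? ?]; split; rewrite ?src_ginv ?tgt_ginv. Qed.

Fact full_wide_comp g h : full U g -> full U h -> tgt g = src h ->
  full U (gcomp g h).
Proof. by move=> [? ?] [? ?] gh; split; rewrite ?src_gcomp ?tgt_gcomp. Qed.

Definition full_wide : wide_subgroupoid U :=
  WideSubgroupoid (@subset_refl _ _) full_wide_id full_wide_inv full_wide_comp.

Lemma local_le_full (s : local_subgroupoid U) : local_le s (loc full_wide).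
Proof.
move=> x Ux; have [V [H [Vx VU sH]]] := germ_at_local s Ux.
exists V, H, U, full_wide; split=> //; first exact: sH.
exists V; split=> //; first by move=> y Vy; split=> //; exact: VU.
by move=> g [_ [a b]]; split; split=> //; exact: VU.
Qed.

End FullWide.

Section Glob.
Context (U : opens X) (s : local_subgroupoid U).

Definition glob_arrows : set Q :=
  \bigcap_(H in [set H : wide_subgroupoid U | local_le s (loc H)]) (H : set Q).

Fact glob_full : glob_arrows `<=` full U.
Proof. by move=> g /(_ (full_wide U)); apply; exact: local_le_full. Qed.

Fact glob_id x : U x -> glob_arrows (gid Q x).
Proof. by move=> Ux H _; exact: arrows_id. Qed.

Fact glob_inv g : glob_arrows g -> glob_arrows (ginv g).
Proof. by move=> Hg H sH; apply/arrows_inv/Hg. Qed.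

Fact glob_comp g h : glob_arrows g -> glob_arrows h -> tgt g = src h ->
  glob_arrows (gcomp g h).
Proof. by move=> Hg Hh gh H sH; apply: arrows_comp => //; [exact: Hg|exact: Hh]. Qed.

Definition glob : wide_subgroupoid U :=
  WideSubgroupoid glob_full glob_id glob_inv glob_comp.

End Glob.

Definition coherent (U : opens X) (s : local_subgroupoid U) : Prop :=
  local_le s (loc (glob s)).

Definition totally_coherent (s : local_subgroupoid (opensT X)) : Prop :=
  forall U : opens X, coherent (restrict s U).

(* The star of Q|U at x. *)
Definition star (U : set X) (x : X) : set Q := [set g | full U g /\ src g = x].

End Subgroupoids.

Lemma within_comp (S T U : topologicalType) (A : set T) (B : set S)
    (f : S -> T) (g : T -> U) :
  {within A, continuous g} -> {within B, continuous f} -> f @` B `<=` A ->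
  {within B, continuous (g \o f)}.
Proof.
move=> /subspace_continuousP gc /subspace_continuousP fc fBA.
apply/subspace_continuousP => x Bx; have Afx : A (f x) by apply: fBA; exists x.
apply: cvg_comp (gc _ Afx).
move=> N; rewrite /within /= => /(fc _ Bx); rewrite /within /= !nbhs_simpl /=.
by apply: filterS => y By' By; apply: By' => //; apply: fBA; exists y.
Qed.

Section Paths.
Context (R : realType) (T : topologicalType).
Implicit Types (A B : set T) (a b c : T).

(* Paths in a subspace A of T are functions on R, of which only the restriction
   to [0,1] matters. *)
Definition joined_in A a b : Prop :=
  exists f : R -> T, [/\ {within `[0, 1], continuous f},
    f @` `[0, 1] `<=` A, f 0 = a & f 1 = b].

Lemma joined_in_refl A a : A a -> joined_in A a a.
Proof.
move=> Aa; exists (cst a); split=> //; last by move=> _ [t _ <-].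
by apply: continuous_subspaceT => t; exact: cvg_cst.
Qed.

Lemma joined_inS A B a b : A `<=` B -> joined_in A a b -> joined_in B a b.
Proof.
by move=> AB [f [fc fA f0 f1]]; exists f; split=> //; exact: subset_trans AB.
Qed.

Lemma joined_in_sym A a b : joined_in A a b -> joined_in A b a.
Proof.
move=> [f [fc fA <- <-]]; exists (f \o (fun t => 1 - t)); split.
- apply: (@within_comp R R T (`[0, 1] : set R) _ (fun t : R => 1 - t) f) => //.
    by apply: continuous_subspaceT => t; apply: cvgB; [exact: cvg_cst|exact: cvg_id].
  by move=> _ [t /= + <-]; rewrite !in_itv/=; lra.
- move=> _ [t t01 <-]; apply: fA; exists (1 - t) => //.
  by move: t01; rewrite /= !in_itv/=; lra.
- by rewrite /= subr0.
- by rewrite /= subrr.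
Qed.

Lemma joined_in_trans A a b c :
  joined_in A a b -> joined_in A b c -> joined_in A a c.
Proof.
move=> [f [fc fA <- f1]] [g [gc gA g0 <-]].
pose h (t : R) := if t <= 2^-1 then f (2 * t) else g (2 * t - 1).
exists h; split.
- have -> : `[0, 1]%classic = `[0, 2^-1] `|` `[2^-1, 1] :> set R.
    apply/seteqP; split=> t; rewrite /= !in_itv/=; last by case; lra.
    by have [t2 ?|t2 ?] := lerP t 2^-1; [left|right]; lra.
  apply: withinU_continuous; [exact: interval_closed|exact: interval_closed| |].
  + apply: (@subspace_eq_continuous _ _ _ (f \o (fun t => 2 * t))).
      move=> t /set_mem; rewrite /= in_itv/= => /andP[_ t2].
      by have <- : h t = f (2 * t) by rewrite /h t2.
    apply: (@within_comp R R T (`[0, 1] : set R) _ (fun t : R => 2 * t) f) => //.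
      by apply: continuous_subspaceT => t; apply: cvgMr; exact: cvg_id.
    by move=> _ [t /= + <-]; rewrite !in_itv/=; lra.
  + apply: (@subspace_eq_continuous _ _ _ (g \o (fun t => 2 * t - 1))).
      move=> t /set_mem; rewrite /= in_itv/= => t2.
      suff <- : h t = g (2 * t - 1) by [].
      rewrite /h; have [t2'|//] := lerP t 2^-1.
      have [-> ->] : 2 * t = 1 /\ 2 * t - 1 = 0 by lra.
      by rewrite f1 g0.
    apply: (@within_comp R R T (`[0, 1] : set R) _ (fun t : R => 2 * t - 1) g) => //.
      apply: continuous_subspaceT => t; apply: cvgB; last exact: cvg_cst.
      by apply: cvgMr; exact: cvg_id.
    by move=> _ [t /= + <-]; rewrite !in_itv/=; lra.
- move=> _ [t + <-]; rewrite /h /= in_itv/= => t01.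
  have [t2|t2] := lerP t 2^-1; [apply: fA|apply: gA].
    by exists (2 * t) => //=; rewrite in_itv/=; lra.
  by exists (2 * t - 1) => //=; rewrite in_itv/=; lra.
- by rewrite /h ifT ?mulr0//; lra.
- by rewrite /h ifF; [congr g; lra|apply/negbTE; rewrite -ltNge; lra].
Qed.

End Paths.

Lemma joined_in_comp (R : realType) (S T : topologicalType) (A : set S)
    (B : set T) (h : S -> T) (a b : S) :
  {within A, continuous h} -> h @` A `<=` B ->
  joined_in R A a b -> joined_in R B (h a) (h b).
Proof.
move=> hc hB [f [fc fA <- <-]]; exists (h \o f); split=> //.
  exact: within_comp hc fc fA.
by move=> _ [t t01 <-]; apply: hB; exists (f t) => //; apply: fA; exists t.
Qed.

Section PathComponent.
Context (R : realType) (X : topologicalType) (Q : topGroupoid X).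

Lemma within_gcomp (g : Q) :
  {within [set h : Q | tgt g = src h], continuous (gcomp g)}.
Proof.
apply/subspace_continuousP => h gh.
have /subspace_continuousP/(_ (g, h) gh) cc := @gcomp_continuous _ Q.
move=> N /cc; rewrite /within /= nbhs_simpl /= => -[[N1 N2] /= [N1g N2h] N12].
rewrite /within /= nbhs_simpl /=; apply: filterS N2h => k N2k gk.
by apply: (N12 (g, k)) => //; split=> //; exact: nbhs_singleton.
Qed.

Section C1.
Context (U : opens X).

Definition C1_arrows : set Q :=
  [set g | full U g /\ joined_in R (star U (src g)) g (gid Q (src g))].

Fact C1_full : C1_arrows `<=` full U.
Proof. by move=> g []. Qed.

Fact C1_id x : U x -> C1_arrows (gid Q x).
Proof.
move=> Ux; have Ug := full_wide_id Q Ux; split=> //.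
by rewrite src_gid; apply: joined_in_refl; split; rewrite ?src_gid.
Qed.

Lemma joined_in_gcomp (g a b : Q) : full U g ->
  joined_in R (star U (tgt g)) a b ->
  joined_in R (star U (src g)) (gcomp g a) (gcomp g b).
Proof.
move=> Ug; apply: joined_in_comp; first last.
  move=> _ [h [Uh gh] <-]; split; last by rewrite src_gcomp.
  exact: full_wide_comp.
by apply: continuous_subspaceW (within_gcomp (g := g)) => h [].
Qed.

Fact C1_inv g : C1_arrows g -> C1_arrows (ginv g).
Proof.
move=> [Ug gJ]; have Ug' := full_wide_inv Ug; split=> //; rewrite src_ginv.
have := @joined_in_gcomp (ginv g) g (gid Q (src g)) Ug'.
rewrite tgt_ginv src_ginv gcompVg => /(_ gJ) /joined_in_sym.
by have := gcompg1 (ginv g); rewrite tgt_ginv => ->.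
Qed.

Fact C1_comp g h : C1_arrows g -> C1_arrows h -> tgt g = src h ->
  C1_arrows (gcomp g h).
Proof.
move=> [Ug gJ] [Uh hJ] gh; split; first exact: full_wide_comp.
rewrite src_gcomp //; apply: joined_in_trans gJ.
by rewrite -[X in joined_in _ _ _ X]gcompg1 gh; apply: joined_in_gcomp; rewrite ?gh.
Qed.

(* C_1(Q|U); in particular C_1(Q) is C1 R Q (opensT X). *)
Definition C1 : wide_subgroupoid Q U :=
  WideSubgroupoid C1_full C1_id C1_inv C1_comp.

End C1.

Section Cover.
Context (I : Type) (UU : I -> opens X).

Definition is_cover : Prop := \bigcup_i UU i = [set: X].

Definition path_compatible : Prop :=
  forall i j x, UU i x -> UU j x ->
    exists W : opens X, [/\ W x, W `<=` UU i `&` UU j &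
      restr (C1 (UU i)) W = restr (C1 (UU j)) W].

Definition path_local : Prop :=
  forall (U : opens X) i j x, UU i x -> UU j x -> U x ->
    exists W : opens X, [/\ W x, W `<=` UU i `&` UU j `&` U &
      restr (C1 (UU i)) W = restr (C1 (opensI (UU j) U)) W].

Section LocalC1.
Context (coverUU : is_cover) (compatUU : path_compatible).

(* Under path compatibility, all the germs in this union are equal. *)
Definition c1_germ (x : X) : set (pregerm Q) :=
  \bigcup_(i in [set i | UU i x]) germ x (C1 (UU i)).

Fact c1_germE i x : UU i x -> c1_germ x = germ x (C1 (UU i)).
Proof.
move=> Ui; apply/seteqP; split=> [p [j Uj]|p]; last by exists i.
by have /germP -> := compatUU Uj Ui.
Qed.

Fact c1_local x : opensT X x ->
  exists (V : opens X) (H : wide_subgroupoid Q V),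
    [/\ V x, V `<=` opensT X & forall y, V y -> c1_germ y = germ y H].
Proof.
move=> _; have : [set: X] x by [].
rewrite -coverUU => -[i _ Ui]; exists (UU i), (C1 (UU i)); split=> // y.
exact: c1_germE.
Qed.

Definition c1 : local_subgroupoid Q (opensT X) := LocalSubgroupoid c1_local.

End LocalC1.
End Cover.
End PathComponent.

(* Main.v *)
Require Import Defs.
From mathcomp Require Import all_boot all_order all_algebra.
From mathcomp Require Import boolp classical_sets reals topology.
From mathcomp Require Import normedtype.
From mathcomp Require Import ring lra.

(** The whole proposition rests on one local-to-global principle
    ([C1_subset_of_local]): if a subgroupoid [H] contains C_1(Q|W) for some open
    neighbourhood [W] of each point of [V], then [H] contains C_1(Q|V).  Indeed,
    let [a] be a path in the star of [x] from [1_x] to [g].  For [s] close to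
    [t], the targets of [a] between [t] and [s] stay in a small [W], so the
    translated path [a(t)^-1 a(u)] lies in the star of [tgt (a t)] in Q|W, and
    [a(t)^-1 a(s)] belongs to C_1(Q|W), hence to [H].  Membership of [a(t)] in
    [H] is therefore a locally constant property of [t], and so constant, as
    [0, 1] is connected; it holds at [0], hence at [1].

    A wide subgroupoid [H] of Q|U with c_1 <= loc(H) on [U] satisfies this local
    hypothesis at each point of [U], because C_1 is monotone in the open set
    ([c1_le_local]).  So [H] contains C_1(Q|V) for every open [V] in [U]
    ([C1_subset_glob]).  With [V = U = X] this is one inclusion in (i); the other
    one holds because monotonicity of C_1 makes C_1(Q) one of the subgroupoids
    that define the glob.  That fact, c_1 <= loc(C_1(Q)), combined with (i) is
    (ii).  For (iii), path locality replaces the germ of C_1(Q|U_i) at [x] by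
    that of C_1(Q|(U_i `&` U)), which the principle places inside the glob of the
    restriction to [U]. *)

Set Implicit Arguments.
Unset Strict Implicit.
Unset Printing Implicit Defensive.

Import Order.TTheory GRing.Theory Num.Theory numFieldNormedType.Exports.
Local Open Scope classical_set_scope.
Local Open Scope ring_scope.

(** * Locally constant properties along a path *)

(** The part of [A] where [P] holds is open and closed in [A]. *)
Lemma locally_constant_connected (T : topologicalType) (A P : set T) (a b : T) :
  connected A ->
  (forall t, A t -> \forall s \near t, A s -> (P s <-> P t)) ->
  A a -> A b -> P a -> P b.
Proof.
move=> cA locP Aa Ab Pa.
suff APA : A `&` P = A by move: Ab; rewrite -APA => -[].
apply: cA; first by exists a.
- exists [set s | A s -> P s]°; first exact: open_interior.
  apply/seteqP; split=> t [At]; last by move/interior_subset => /(_ At).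
  by move=> Pt; split=> //; apply: filterS (locP t At) => s sP /sP ->.
- exists (~` [set s | A s -> ~ P s]°).
    by rewrite closedC; exact: open_interior.
  apply/seteqP; split=> t [At].
    by move=> Pt; split=> // /interior_subset /(_ At).
  move=> nPt; split=> //; apply: contrapT => nP; apply: nPt.
  by apply: filterS (locP t At) => s sP /sP ->.
Qed.

Lemma joined_in_ends (R : realType) (T : topologicalType) (A : set T) (a b : T) :
  joined_in R A a b -> A a /\ A b.
Proof.
move=> [f [_ fA <- <-]].
by split; apply: fA; [exists 0|exists 1]; rewrite //= in_itv /= lexx ler01.
Qed.

Lemma joined_in_subpath (R : realType) (T : topologicalType) (A : set T)
    (f : R -> T) (t s : R) :
  {within `[0, 1], continuous f} -> `[0, 1]%classic t -> `[0, 1]%classic s ->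
  (forall u, 0 <= u <= 1 -> A (f (t + u * (s - t)))) ->
  joined_in R A (f t) (f s).
Proof.
rewrite /= !in_itv /= => fc t01 s01 fA.
exists (f \o (fun u => t + u * (s - t))); split.
- apply: (@within_comp R R T (`[0, 1] : set R) _ (fun u : R => t + u * (s - t)) f) => //.
    apply: continuous_subspaceT => u; apply: cvgD; first exact: cvg_cst.
    by apply: cvgM; [exact: cvg_id|exact: cvg_cst].
  by move=> _ [u /= + <-]; rewrite !in_itv/=; nra.
- by move=> _ [u + <-]; rewrite /= in_itv /= => /fA.
- by rewrite /= mul0r addr0.
- by rewrite /= mul1r addrC subrK.
Qed.

(** * The local-to-global principle for C_1 *)

Section LocalToGlobal.
Context (R : realType) (X : topologicalType) (Q : topGroupoid X).

Lemma C1S (U V : opens X) : U `<=` V -> C1 R Q U `<=` (C1 R Q V : set Q).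
Proof.
move=> UV g [[Us Ut] gJ]; split; first by split; exact: UV.
apply: joined_inS gJ => h [[? ?] ?]; split=> //.
by split; exact: UV.
Qed.

(** Left translation by [b^-1] carries a path from [b] to [c] to a path from the
    identity at [tgt b], which stays over [W] as soon as the targets along the
    given path do: the source of [b] is arbitrary. *)
Lemma C1_translate (W : opens X) (b c : Q) :
  joined_in R [set h : Q | src h = src b /\ W (tgt h)] b c ->
  C1 R Q W (gcomp (ginv b) c).
Proof.
move=> bc.
have [[_ Wb] [sc Wc]] := joined_in_ends bc.
have Vbc : tgt (ginv b) = src c by rewrite tgt_ginv sc.
have sbc : src (gcomp (ginv b) c) = tgt b by rewrite src_gcomp // src_ginv.
split; first by split; rewrite ?sbc ?tgt_gcomp.
rewrite sbc -gcompVg; apply: joined_in_comp (joined_in_sym bc).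
  apply: continuous_subspaceW (within_gcomp (g := ginv b)) => h [sh _] /=.
  by rewrite tgt_ginv sh.
move=> _ [h [sh Wh] <-]; have Vbh : tgt (ginv b) = src h by rewrite tgt_ginv sh.
by split; [split|]; rewrite ?src_gcomp ?tgt_gcomp ?src_ginv.
Qed.

(** [c] is [b] times the translated arrow [b^-1 c], which lies in [H] by
    hypothesis.  Reversing the path gives the converse, so membership in [H] is
    the same at both ends. *)
Lemma mem_of_joined_over (U W : opens X) (H : wide_subgroupoid Q U) (b c : Q) :
  C1 R Q W `<=` (H : set Q) ->
  joined_in R [set h : Q | src h = src b /\ W (tgt h)] b c -> H b -> H c.
Proof.
move=> WH bc Hb; have Hbc := WH _ (C1_translate bc).
have [_ [sc _]] := joined_in_ends bc.
have -> : c = gcomp b (gcomp (ginv b) c).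
  by rewrite gcompA ?src_ginv ?tgt_ginv // gcompgV -sc gcomp1g.
by apply: arrows_comp => //; rewrite src_gcomp ?src_ginv // tgt_ginv.
Qed.

(** Along a path in a star, membership in [H] is locally constant by
    [mem_of_joined_over], so it passes from the identity to the far end. *)
Lemma C1_subset_of_local (U V : opens X) (H : wide_subgroupoid Q U) :
  (forall x, V x -> exists W : opens X, W x /\ C1 R Q W `<=` (H : set Q)) ->
  C1 R Q V `<=` (H : set Q).
Proof.
move=> locH g [[Vs Vt] /joined_in_sym [f [fc fV f0 f1]]].
have fS t : `[0, 1]%classic t -> src (f t) = src g /\ V (tgt (f t)).
  by move=> t01; have [|[_ ?] ?] := fV (f t); first by exists t.
rewrite -f1.
apply: (@locally_constant_connected R `[0, 1]%classic (fun t => H (f t)) 0 1).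
- exact: segment_connected.
- move=> t t01; have [st Vft] := fS _ t01.
  have [W [Wt WH]] := locH _ Vft.
  have : \forall s \near t, `[0, 1]%classic s -> W (tgt (f s)).
    have /subspace_continuousP/(_ t t01) ft := fc.
    apply: (ft [set h | W (tgt h)]).
    by apply: (@tgt_continuous _ Q (f t)); apply: open_nbhs_nbhs; split=> //;
      exact: oset_open.
  move=> /nbhs_ballP [e /= e0 tW]; apply/nbhs_ballP; exists e => // s ts s01.
  (* balls of the line are convex, so the whole segment from [t] to [s] is
     mapped over [W] *)
  have ts_joined : joined_in R [set h : Q | src h = src g /\ W (tgt h)] (f t) (f s).
    apply: joined_in_subpath => // u u01.
    have u01' : `[0, 1]%classic (t + u * (s - t)).
      by move: t01 s01; rewrite /= !in_itv /=; nra.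
    split; first exact: (fS _ u01').1.
    apply: tW u01'; move: ts; rewrite /ball /= => ts.
    have -> : t - (t + u * (s - t)) = u * (t - s) by ring.
    apply: le_lt_trans ts; case/andP: u01 => u0 u1.
    by rewrite normrM (ger0_norm u0) ler_piMl.
  have [ss _] := fS _ s01.
  split; apply: (@mem_of_joined_over _ W) => //.
    by rewrite ss; exact: joined_in_sym.
  by rewrite st.
- by rewrite /= in_itv /= lexx ler01.
- by rewrite /= in_itv /= lexx ler01.
(* the starting identity lies in [C1] of any neighbourhood of its object *)
- have [W [Wg WH]] := locH _ Vs.
  by rewrite f0; apply: WH; exact: C1_id.
Qed.

End LocalToGlobal.

(** * The local subgroupoid c_1 and its glob *)

Section GlobC1.
Context (R : realType) (X : topologicalType) (Q : topGroupoid X) (I : Type).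
Context (UU : I -> opens X).
Context (coverUU : is_cover UU) (compatUU : path_compatible R Q UU).

Let s : local_subgroupoid Q (opensT X) := c1 coverUU compatUU.

Lemma exists_cover x : exists i, UU i x.
Proof.
by have : [set: X] x by []; rewrite -coverUU => -[i _ Ui]; exists i.
Qed.

(** The order on germs only controls the arrows of C_1(Q|U_i) over a smaller
    open set [W], but these include all of C_1(Q|W). *)
Lemma c1_le_local (U : opens X) (H : wide_subgroupoid Q U) :
  local_le (restrict s U) (loc H) ->
  forall x, U x -> exists W : opens X, W x /\ C1 R Q W `<=` (H : set Q).
Proof.
move=> sH x Ux; have [i Ui] := exists_cover x.
have := sH x Ux; rewrite /= (c1_germE compatUU Ui) => /(germ_leP _ _ Ui Ux).
move=> [W [Wx WU WH]]; exists W; split=> // g Wg.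
have [|//] := WH g; split; last exact: C1_full Wg.
by apply: C1S Wg => y /WU[].
Qed.

Lemma C1_subset_glob (U V : opens X) : V `<=` U ->
  C1 R Q V `<=` (glob (restrict s U) : set Q).
Proof.
move=> VU g Vg H /= sH; apply: C1_subset_of_local Vg => x /VU.
exact: c1_le_local.
Qed.

Lemma c1_le_C1 : local_le s (loc (C1 R Q (opensT X))).
Proof.
move=> x _; have [i Ui] := exists_cover x.
rewrite /= (c1_germE compatUU Ui); apply/germ_leP => //.
exists (UU i); split=> // g [Ug ?]; split=> //.
by apply: C1S Ug.
Qed.

Lemma glob_c1 : glob s = C1 R Q (opensT X) :> set Q.
Proof.
apply/seteqP; split=> [g|]; first by apply; exact: c1_le_C1.
exact: (@C1_subset_glob (opensT X) (opensT X)).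
Qed.

Lemma c1_coherent : coherent s.
Proof.
move=> x _; have := @c1_le_C1 x Logic.I.
have [i Ui] := exists_cover x.
rewrite /= (c1_germE compatUU Ui) => /(germ_leP _ (C1 R Q (opensT X)) Ui Logic.I) WC.
by apply/germ_leP => //; rewrite glob_c1.
Qed.

Lemma c1_totally_coherent : path_local R Q UU -> totally_coherent s.
Proof.
move=> locUU U x Ux; have [i Ui] := exists_cover x.
have [W [Wx WU CW]] := locUU U i i x Ui Ui Ux.
rewrite /= (c1_germE compatUU Ui); apply/germ_leP => //.
exists W; split=> //; first by move=> y /WU[[]].
rewrite CW => g [Cg Wg]; split=> //.
by apply: C1_subset_glob Cg => y [].
Qed.

End GlobC1.

Theorem proposition6p13 (R : realType) (X : topologicalType)
    (Q : topGroupoid X) (I : Type) (UU : I -> opens X)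
    (coverUU : is_cover UU) (compatUU : path_compatible R Q UU) :
  [/\ glob (c1 coverUU compatUU) = C1 R Q (opensT X) :> set Q,
      coherent (c1 coverUU compatUU) &
      path_local R Q UU -> totally_coherent (c1 coverUU compatUU)].
Proof.
split; [exact: glob_c1|exact: c1_coherent|exact: c1_totally_coherent].
Qed.
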